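(* Let $q$ be a prime power, let $n$ be a non-negative integer, and let $M_q$ be a coordinate $q$-matroid on $\mathbb{F}_q^n$. If the corresponding matroid of $M_q$ (a matroid on $[n]$) is a transversal matroid, then $M_q$ is a transversal $q$-matroid and $M_q$ is representable.
   Context: A $q$-matroid $M=(E,\rho)$ consists of a finite-dimensional vector space $E$ over a finite field $\mathbb{F}_q$ and a function $\rho$ from the set of subspaces of $E$ to $\mathbb{Z}_{\ge 0}$ such that for all $X,Y\le E$: $0\le\rho(X)\le\dim X$; $X\le Y$ implies $\rho(X)\le\rho(Y)$; and $\rho(X+Y)+\rho(X\cap Y)\le\rho(X)+\rho(Y)$. A subspace $X$ is independent if $\rho(X)=\dim X$; it is a flat if $\rho(X)<\rho(X\oplus\langle v\rangle)$ for all $v\in E\setminus X$; it is cyclic if $\rho(H)=\rho(X)$ for every hyperplane $H$ of $X$ (subspace of $X$ of dimension $\dim X-1$); it is a cyclic flat if it is both. A $q$-matroid is determined by its independent spaces, and also by its weighted cyclic flats $(\mathcal{Z},\lambda)$, where $\mathcal{Z}$ is the set of its cyclic flats and $\lambda=\rho|_{\mathcal{Z}}$. Analogously for a matroid $(S,r)$: $X\subseteq S$ is a flat if $r(X)<r(X\cup\{s\})$ for all $s\in S\setminus X$, cyclic if $r(X\setminus\{x\})=r(X)$ for all $x\in X$, a cyclic flat if both; a matroid is determined by its weighted cyclic flats. A subspace of $\mathbb{F}_q^n$ is coordinate if it is spanned by a subset of the standard basis vectors $e_1,\dots,e_n$. A coordinate $q$-matroid is a $q$-matroid on $\mathbb{F}_q^n$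 all of whose cyclic flats are coordinate subspaces. For $S\subseteq[n]$ let $\phi(S)=\langle e_i:i\in S\rangle$; for a coordinate subspace $X$, $\phi^{-1}(X)$ is the unique $S\subseteq[n]$ with $\phi(S)=X$. If $M_q$ is a coordinate $q$-matroid with weighted cyclic flats $(\mathcal{Z},\lambda)$, its corresponding matroid is the (existing and unique) matroid on $[n]$ whose weighted cyclic flats are $(\{\phi^{-1}(Z):Z\in\mathcal{Z}\},\lambda\circ\phi)$. Given a finite family (repetitions allowed) $\mathcal{A}$ of $k$ subsets of a set, a finite set $X$ has an avoidance transversal of $\mathcal{A}$ if there are orderings $X=\{x_1,\dots,x_\ell\}$ and $\mathcal{A}=(A_1,\dots,A_k)$, with $\ell\le k$, such that $x_i\notin A_i$ for each $i\in[\ell]$. A matroid on a finite set $S$ is an (avoidance) transversal matroid if there is a finite family $\mathcal{A}$ of subsets of $S$ (a presentation) such that its independent sets are exactly the subsets of $S$ that have an avoidance transversal of $\mathcal{A}$; by taking complements this is the same as the usual notion of transversal matroid. A $q$-matroid on $E$ is a transversal $q$-matroid if there is a finite family $\mathcal{X}=(X_1,\dots,X_k)$ of subspaces of $E$ (a presentation) such that its independent spaces are exactly the partial $q$-transversals of $\mathcal{X}$, i.e. the subspaces $X\le E$ such that every linear basis of $X$ has an avoidance transversal of $\mathcal{X}$. A $q$-matroid $(\mathbb{F}_q^n,\rho)$ is representable if there are $m\ge 1$ and a matrix $G$ with $n$ columns over $\mathbb{F}_{q^m}$ such that $\rho(X)=\operatorname{rank}_{\mathbb{F}_{q^m}}(GA_X^{T})$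 for every $X\le\mathbb{F}_q^n$, where $A_X$ is any matrix over $\mathbb{F}_q$ whose row space is $X$. *)

(* Defs.v *)
From HB Require Import structures.
From mathcomp Require Import all_boot all_order all_algebra all_fingroup all_field.

Set Implicit Arguments.
Unset Strict Implicit.
Unset Printing Implicit Defensive.

Import GRing.Theory.

(* The finite set X is given as a duplicate-free list. Its orderings are the   *)
(* lists xs with perm_eq xs X; the orderings of the family A are the A \o s.   *)
Definition has_avoidance_transversal (T : eqType) (k : nat)
    (A : 'I_k -> {pred T}) (X : seq T) : Prop :=
  exists (xs : seq T) (s : 'S_k),
    [/\ perm_eq xs X,
        (size xs <= k)%N &
        forall (x0 : T) (i : 'I_k),
          (i < size xs)%N -> nth x0 xs i \notin A (s i)].

Record matroid (S : finType) := Matroid {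
  mrank : {set S} -> nat;
  mrank_le_card : forall X, (mrank X <= #|X|)%N;
  mrank_mono : forall X Y : {set S}, X \subset Y -> (mrank X <= mrank Y)%N;
  mrank_submod : forall X Y : {set S},
    (mrank (X :|: Y) + mrank (X :&: Y) <= mrank X + mrank Y)%N
}.

Section MatroidDefs.
Variables (S : finType) (M : matroid S).
Implicit Type X : {set S}.

Definition mindependent X : Prop := mrank M X = #|X|.

Definition mflat X : Prop :=
  forall s, s \notin X -> (mrank M X < mrank M (s |: X))%N.

Definition mcyclic X : Prop :=
  forall x, x \in X -> mrank M (X :\ x) = mrank M X.

Definition mcyclic_flat X : Prop := mflat X /\ mcyclic X.

Definition transversal_matroid : Prop :=
  exists (k : nat) (A : 'I_k -> {set S}),
    forall X, mindependent X <->
      has_avoidance_transversal (fun i => A i) (enum X).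

End MatroidDefs.

Record qmatroid (F : finFieldType) (E : vectType F) := QMatroid {
  qrank : {vspace E} -> nat;
  qrank_le_dim : forall X, (qrank X <= \dim X)%N;
  qrank_mono : forall X Y : {vspace E}, (X <= Y)%VS -> (qrank X <= qrank Y)%N;
  qrank_submod : forall X Y : {vspace E},
    (qrank (X + Y)%VS + qrank (X :&: Y)%VS <= qrank X + qrank Y)%N
}.

Section QMatroidDefs.
Variables (F : finFieldType) (E : vectType F) (M : qmatroid E).
Implicit Type X : {vspace E}.

Definition qindependent X : Prop := qrank M X = \dim X.

Definition qflat X : Prop :=
  forall v, v \notin X -> (qrank M X < qrank M (X + <[v]>)%VS)%N.

Definition qcyclic X : Prop :=
  forall H : {vspace E},
    (H <= X)%VS -> (\dim H).+1 = \dim X -> qrank M H = qrank M X.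

Definition qcyclic_flat X : Prop := qflat X /\ qcyclic X.

Definition partial_qtransversal (k : nat) (Xs : 'I_k -> {vspace E}) X : Prop :=
  forall b : seq E,
    basis_of X b -> has_avoidance_transversal (fun i => Xs i) b.

Definition transversal_qmatroid : Prop :=
  exists (k : nat) (Xs : 'I_k -> {vspace E}),
    forall X, qindependent X <-> partial_qtransversal Xs X.

End QMatroidDefs.

Section Coordinate.
Variables (F : finFieldType) (n : nat).

Definition coord_space (S : {set 'I_n}) : {vspace 'rV[F]_n} :=
  <<[seq (delta_mx 0%R i : 'rV[F]_n) | i in S]>>%VS.

Definition is_coordinate (X : {vspace 'rV[F]_n}) : Prop :=
  exists S : {set 'I_n}, X = coord_space S.

Definition coordinate_qmatroid (M : qmatroid 'rV[F]_n) : Prop :=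
  forall Z, qcyclic_flat M Z -> is_coordinate Z.

(* As coord_space is injective, the preimages under coord_space of the cyclic  *)
(* flats of a coordinate M are exactly the S with coord_space S a cyclic flat. *)
Definition corresponding_matroid (M : qmatroid 'rV[F]_n)
    (N : matroid 'I_n) : Prop :=
  (forall S, mcyclic_flat N S <-> qcyclic_flat M (coord_space S)) /\
  (forall S, mcyclic_flat N S -> mrank N S = qrank M (coord_space S)).

Definition row_space (a : nat) (A : 'M[F]_(a, n)) : {vspace 'rV[F]_n} :=
  <<[seq row i A | i : 'I_a]>>%VS.

(* A fieldExtType over F is finite-dimensional, so L ranges over the fields    *)
(* F_{q^m} with m = \dim {:L} >= 1.                                            *)
Definition representable (M : qmatroid 'rV[F]_n) : Prop :=
  exists (L : fieldExtType F) (k : nat) (G : 'M[L]_(k, n)),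
    forall (X : {vspace 'rV[F]_n}) (a : nat) (A : 'M[F]_(a, n)),
      row_space A = X ->
      qrank M X = \rank (G *m (map_mx (in_alg L) A)^T)%R.

End Coordinate.

(* Main.v *)
Require Import Defs.
From HB Require Import structures.
From mathcomp Require Import all_boot all_order all_algebra all_fingroup all_field.
From mathcomp Require Import zify.
From Stdlib Require Import Classical.

(* Let (A_j), j in 'I_k, be a presentation of N, let A_J be the intersection   *)
(* of the A_j for j in J, and write phi for coord_space. The rank function of  *)
(* Mq turns out to be                                                          *)
(*   rho(X) = min_J (dim X - dim (X :&: phi(A_J)) + k - |J|).                  *)
(* A q-matroid rank is the minimum of rho(Z) + dim X - dim (X :&: Z) over the  *)
(* cyclic flats Z; by Koenig's theorem a cyclic flat S of N lies in some A_J   *)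
(* with r(S) = k - |J|, while r(A_J) <= k - |J| always.                        *)
(* Hence X is independent iff dim (X :&: phi(A_J)) <= k - |J| for all J, which *)
(* is Hall's condition for all bases of X with respect to the phi(A_j).        *)
(* A matrix whose row j vanishes on A_j and is otherwise generic has the same  *)
(* rank function. Generic rows are obtained one at a time: over an extension   *)
(* of degree at least n a row with linearly independent entries cuts down by   *)
(* one every subspace defined over the base field on which it is not forced to *)
(* vanish, and the next row lives over a further extension of that extension.  *)

Set Implicit Arguments.
Unset Strict Implicit.
Unset Printing Implicit Defensive.

Import GRing.Theory.

(** Write f(X, J) = dim X - dim (X :&: phi(A_J)) + k - |J|. Both conclusions follow by comparison
    with the minimum of f over J. [coord_qrank_le] bounds rho(X) by every f(X, J) and
    [coord_qrank_ge] finds a J attaining the bound. These rest on [qcyclic_flat_rank_le] for Mq, and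
    on [transversal_rank_bigcap_le] and [transversal_rank_cyclic] for N. Transversality:
    [qindependent_coordP] and [partial_qtransversal_coordP] turn independence and being a partial
    q-transversal into the same Hall inequalities. Representability: [rank_mulmx_zero_pattern_le]
    and [generic_mx] are the two halves of the same formula for the rank of the space times a matrix
    B. The representing matrix is the transpose of B, so the generic rows described above are built
    as columns of B. *)

(** * Avoidance transversals and Hall's theorem *)

(* Rado's deletion argument: a row with two elements can lose one of them     *)
(* without violating the condition, so all rows may be assumed to have at     *)
(* most one element.                                                          *)
Lemma hall_deficiency (T U : finType) (d : nat) (N : {ffun T -> {set U}}) :
  (forall L : {set T}, #|L| <= #|\bigcup_(x in L) N x| + d) ->
  exists f : {ffun T -> option U},
    [/\ forall x y u, f x = Some u -> f y = Some u -> x = y,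
        forall x u, f x = Some u -> u \in N x &
        #|T| <= #|[set x | f x]| + d].
Proof.
have [m] := ubnP (\sum_x #|N x|); elim: m N => // m IHm N ltNm hallN.
have [/existsP[x0 N_gt1] | /existsPn N_le1] := boolP [exists x, 1 < #|N x|].
  pose del u := [ffun x => if x == x0 then N x :\ u else N x].
  have delsub u x : del u x \subset N x.
    by rewrite ffunE; case: eqP => // _; apply: subsetDl.
  have IHdel u : u \in N x0 ->
    (forall L : {set T}, #|L| <= #|\bigcup_(x in L) del u x| + d) ->
    exists f : {ffun T -> option U},
    [/\ forall x y u, f x = Some u -> f y = Some u -> x = y,
        forall x u, f x = Some u -> u \in N x &
        #|T| <= #|[set x | f x]| + d].
    move=> Nu hallu; have [||f [finj fN fcard]] := IHm (del u) => //.
      rewrite -ltnS; apply: leq_trans ltNm; rewrite ltnS (bigD1 x0) //=.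
      rewrite [X in _ < X](bigD1 x0) //= ffunE eqxx (cardsD1 u (N x0)) Nu.
      by rewrite -addSn leq_add // leq_sum // => x _; apply: subset_leq_card.
    exists f; split=> // x v /fN; exact/subsetP.
  have /card_gt1P[u [v [Nu Nv uv]]] := N_gt1.
  have [/forallP|/forallPn[L1 bad1]] := boolP
    [forall L : {set T}, #|L| <= #|\bigcup_(x in L) del u x| + d].
    exact: IHdel.
  have [/forallP|/forallPn[L2 bad2]] := boolP
    [forall L : {set T}, #|L| <= #|\bigcup_(x in L) del v x| + d].
    exact: IHdel.
  (* Only the row of x0 was changed, so every violating set contains x0. *)
  have in0 (w : U) (L : {set T}) :
    ~~ (#|L| <= #|\bigcup_(x in L) del w x| + d) -> x0 \in L.
    apply: contraR => x0L; have -> // : \bigcup_(x in L) del w x = \bigcup_(x in L) N x.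
    by apply: eq_bigr => x xL; rewrite ffunE; case: eqP xL x0L => // -> ->.
  have [L1x0 L2x0] := (in0 _ _ bad1, in0 _ _ bad2).
  set N1 := \bigcup_(x in L1) del u x in bad1.
  set N2 := \bigcup_(x in L2) del v x in bad2.
  (* Double counting: Hall for L1 :|: L2 and for (L1 :&: L2) minus x0 gives |L1| + |L2| - 1 <= |N1|
     + |N2| + 2d, while the two violations give |L1| + |L2| >= |N1| + |N2| + 2d + 2. The union bound
     needs u != v: each deleted element survives in the other deletion. *)
  have capS : \bigcup_(x in (L1 :&: L2) :\ x0) N x \subset N1 :&: N2.
    apply/bigcupsP=> x /setD1P[xx0 /setIP[xL1 xL2]]; rewrite subsetI.
    rewrite /N1 /N2; apply/andP; split.
      by apply: (bigcup_max x) => //; rewrite ffunE (negPf xx0).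
    by apply: (bigcup_max x) => //; rewrite ffunE (negPf xx0).
  have cupS : \bigcup_(x in L1 :|: L2) N x \subset N1 :|: N2.
    apply/bigcupsP=> x xL; apply/subsetP=> w Nw; rewrite inE.
    have [xx0|xx0] := eqVneq x x0.
      have [wu|wu] := eqVneq w u; apply/orP; [right | left].
        by apply/bigcupP; exists x0 => //; rewrite ffunE eqxx !inE wu uv.
      by apply/bigcupP; exists x0 => //; rewrite ffunE eqxx !inE wu -xx0.
    case/setUP: xL => xL; apply/orP; [left | right];
      by apply/bigcupP; exists x => //; rewrite ffunE (negPf xx0).
  have := leq_add (subset_leq_card capS) (subset_leq_card cupS).
  have := leq_trans (hallN ((L1 :&: L2) :\ x0)) (leqnn _).
  have := leq_trans (hallN (L1 :|: L2)) (leqnn _).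
  have := cardsUI L1 L2; have := cardsUI N1 N2.
  have := cardsD1 x0 (L1 :&: L2); rewrite inE L1x0 L2x0 /=.
  lia.
have N1 x u v : u \in N x -> v \in N x -> u = v.
  move=> Nu Nv; apply/eqP; apply: contraNT (N_le1 x) => uv.
  by apply/card_gt1P; exists u, v.
(* Rows are now empty or singletons. Each value u in their union is assigned to one row g u
   containing it, and the other rows equal to {u} stay unmatched. *)
pose g u := [pick x | u \in N x].
have [f fP] : exists f : {ffun T -> option U}, forall x,
    (forall u, f x = Some u -> u \in N x /\ g u = Some x) /\
    (forall u, u \in N x -> g u = Some x -> f x).
  exists [ffun x => [pick u in N x | g u == Some x]] => x; rewrite ffunE.
  case: pickP => [u /andP[Nu /eqP gu]|none]; split=> //.
  - by move=> _ [<-].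
  - by move=> v Nv gv; have := none v; rewrite Nv gv eqxx.
exists f; split.
- by move=> x y u /(proj1 (fP x))[_ gx] /(proj1 (fP y))[_]; rewrite gx => -[].
- by move=> x u /(proj1 (fP x))[].
have gP x u : u \in N x -> exists2 y, g u = Some y & u \in N y.
  by rewrite /g; case: pickP => [y Ny _|/(_ x) ->//]; exists y.
rewrite -cardsT; apply: (leq_trans (hallN _)); rewrite leq_add2r.
set V := \bigcup_(x in _) N x.
have -> : #|V| = #|[set g u | u in V]|.
  rewrite card_in_imset // => u v /bigcupP[x _ /gP[y gu Nu]].
  move=> /bigcupP[x' _ /gP[y' gv Nv]]; rewrite gu gv => -[yy'].
  by apply: N1 Nu _; rewrite yy'.
have -> : #|[set x | f x]| = #|[set Some x | x in [set x | f x]]|.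
  by rewrite card_imset // => ? ? [].
apply: subset_leq_card; apply/subsetP=> _ /imsetP[u /bigcupP[x _ /gP[y gu Nu]] ->].
by rewrite gu imset_f // inE; apply: (proj2 (fP y)) Nu gu.
Qed.

(** The list [l] of the values of f followed by the missed elements enumerates 'I_k. Comparing
    indices as naturals spares a proof of a <= k in the statement. *)
Lemma inj_ffun_perm (a k : nat) (f : 'I_a -> 'I_k) :
  injective f -> exists s : 'S_k,
    forall (i : 'I_k) (j : 'I_a), i = j :> nat -> s i = f j.
Proof.
move=> finj; pose l := codom f ++ [seq i <- enum 'I_k | i \notin codom f].
have ul : uniq l.
  rewrite cat_uniq filter_uniq ?enum_uniq // andbT.
  rewrite /codom /image_mem map_inj_uniq ?enum_uniq //=.
  by apply/hasPn=> i; rewrite mem_filter => /andP[].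
have sl : size l = k.
  rewrite -[RHS](card_ord k) cardE; apply/perm_size/uniq_perm => //.
    exact: enum_uniq.
  move=> i; rewrite mem_cat mem_filter mem_enum /= andbT.
  by case: (i \in codom f).
have sinj : injective (fun i : 'I_k => nth i l i).
  move=> i j; rewrite (set_nth_default j) ?sl // => /eqP.
  by rewrite nth_uniq ?sl // => /eqP/val_inj.
exists (perm sinj) => i j ij; rewrite permE /= ij nth_cat size_codom card_ord ltn_ord.
by rewrite (nth_map j) ?size_enum_ord // nth_ord_enum.
Qed.

(** Hall's theorem in complementary form: entries lying in every A j with j in J must be matched to
    indices outside J. Repeated entries count separately, since the matched objects are positions of
    the list. *)
Lemma has_avoidance_transversalP (T : eqType) (k : nat)
    (A : 'I_k -> {pred T}) (X : seq T) :
  has_avoidance_transversal A X <->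
  forall J : {set 'I_k},
    count (fun x => [forall j in J, x \in A j]) X + #|J| <= k.
Proof.
split=> [[xs [s [pX ltk avoid]]] J | hall].
  rewrite -(seq.permP pX); case: xs ltk avoid {pX} => [|x0 xs'].
    by move=> _ _; rewrite -[leqRHS]card_ord max_card.
  set xs := _ :: _ => ltk avoid.
  rewrite -(mkseq_nth x0 xs) count_map -size_filter.
  set I := filter _ _.
  have Ilt i : i \in I -> i < k.
    rewrite mem_filter mem_iota add0n => /andP[_ /andP[_ lti]].
    exact: leq_trans lti ltk.
  have uI : uniq I by rewrite filter_uniq ?iota_uniq.
  pose S := [set s i | i in [set i : 'I_k | val i \in I]].
  have cS : #|S| = size I.
    rewrite card_imset; last exact: perm_inj.
    rewrite cardE -(size_map val); apply/perm_size/uniq_perm => //.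
      by rewrite map_inj_uniq ?enum_uniq //; apply: val_inj.
    move=> i; apply/mapP/idP => [[j]|iI]; first by rewrite mem_enum inE => jI ->.
    by exists (Ordinal (Ilt _ iI)); rewrite // mem_enum inE.
  have dSJ : S \subset ~: J.
    apply/subsetP=> _ /imsetP[i iI ->]; rewrite inE in iI; rewrite inE.
    move: iI; rewrite mem_filter mem_iota add0n => /andP[/= iA lti].
    apply/negP=> sJ; have := avoid x0 i lti.
    by move/forall_inP: iA => /(_ _ sJ) ->.
  by rewrite -cS (leq_trans (leq_add (subset_leq_card dSJ) (leqnn _))) //
             addnC cardsC card_ord.
pose N := [ffun i : 'I_(size X) => [set j | tnth (in_tuple X) i \notin A j]].
have [|f [finj fN]] := @hall_deficiency _ _ 0 N.
  (* Take J to be the complement of the neighbourhood V: all entries at positions in L lie in A j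
     for every j outside V. *)
  move=> L; set V := \bigcup_(x in L) _; have := hall (~: V).
  have := cardsC V; rewrite card_ord addn0 => VC; set c := count _ _ => le.
  suff leLc : #|L| <= c.
    by apply: leq_trans leLc _; rewrite -(leq_add2r #|~: V|) VC.
  rewrite /c -[Y in count _ Y](map_tnth_enum (in_tuple X)) count_map -size_filter.
  rewrite cardE; apply: uniq_leq_size; first exact: enum_uniq.
  move=> i; rewrite mem_enum => iL; rewrite mem_filter mem_enum andbT /=.
  apply/forall_inP=> j; rewrite inE; apply: contraR => jA.
  by apply/bigcupP; exists i => //; rewrite ffunE inE.
rewrite addn0 card_ord -[X in X <= _]card_ord => cf.
have fT : [set x | f x] = setT.
  apply/eqP.
  by rewrite eqEcard subsetT cardsT.
have fS i : exists j, f i = Some j.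
  have : i \in [set x | f x] by rewrite fT inE.
  by rewrite inE; case: (f i) => // j _; exists j.
have /fin_all_exists[g gf] := fS.
have [s sg] : exists s : 'S_k,
    forall (i : 'I_k) (j : 'I_(size X)), i = j :> nat -> s i = g j.
  apply: inj_ffun_perm => i j gij; apply: finj (gf i) _.
  by rewrite gij gf.
exists X, s; split=> //.
  have := hall set0; rewrite cards0 addn0; congr (_ <= _).
  apply/eqP; rewrite -all_count; apply/allP=> x _.
  by apply/forall_inP=> j; rewrite inE.
move=> x0 i lti; have := fN _ _ (gf (Ordinal lti)).
by rewrite (sg i (Ordinal lti)) // ffunE inE (tnth_nth x0).
Qed.

(** Koenig's theorem: the largest matchable Y is certified by the complement J of the neighbourhood
    of a set L of maximal deficiency. Elements outside Z get no neighbours and hence remain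
    unmatched. *)
Lemma max_avoiding_subset (T : finType) (k : nat) (A : 'I_k -> {set T})
    (Z : {set T}) :
  exists (Y : {set T}) (J : {set 'I_k}),
    [/\ Y \subset Z, has_avoidance_transversal (fun j => A j) (enum Y) &
        #|Z :\: \bigcap_(j in J) A j| + k <= #|Y| + #|J|].
Proof.
pose N := [ffun x => [set j | (x \in Z) && (x \notin A j)]].
pose def (L : {set T}) := #|L| - #|\bigcup_(x in L) N x|.
have [|L dL] := eq_bigmax def; first by apply/card_gt0P; exists set0.
have [|f [finj fN fcard]] := @hall_deficiency _ _ (\max_L def L) N.
  move=> L'; have leL' : def L' <= \max_L def L by exact: leq_bigmax.
  by rewrite -leq_subLR.
have {L dL} [L dL] :
    exists L : {set T}, \max_L def L + #|\bigcup_(x in L) N x| = #|L|.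
  (* [def] truncates at 0. If the subtraction is truncated at the maximizer, the maximal deficiency
     is 0 and the empty set attains it exactly. *)
  have [le|lt] := leqP #|\bigcup_(x in L) N x| #|L|.
    by exists L; rewrite dL /def subnK.
  exists set0; rewrite dL big_set0 !cards0 addn0.
  by apply/eqP; rewrite subn_eq0 ltnW.
exists [set x | f x], (~: \bigcup_(x in L) N x); split.
- apply/subsetP=> x; rewrite inE; case fx: (f x) => [u|//] _.
  by have := fN _ _ fx; rewrite ffunE inE => /andP[].
- apply/has_avoidance_transversalP => J.
  rewrite -size_filter; set I := filter _ _.
  have fI x : x \in I -> exists2 j, f x = Some j & j \notin J.
    rewrite mem_filter mem_enum inE => /andP[/forall_inP xJ].
    case fx: (f x) => [j|//] _; exists j => //; apply/negP=> /xJ.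
    by have := fN _ _ fx; rewrite ffunE inE => /andP[_ /negPf ->].
  have uI : uniq I by rewrite filter_uniq ?enum_uniq.
  suff : size I <= #|~: J| by have := cardsC J; rewrite card_ord; lia.
  rewrite -(size_map f) cardE -(size_map Some (enum _)).
  apply: uniq_leq_size.
    rewrite map_inj_in_uniq // => x y /fI[j fx _] /fI[j' fy _].
    by rewrite fx => fxy; apply: (finj x y j).
  move=> _ /mapP[x /fI[j fx jJ] ->]; rewrite fx map_f //.
  by rewrite mem_enum inE.
have sZL : Z :\: \bigcap_(j in ~: \bigcup_(x in L) N x) A j \subset ~: L.
  apply/subsetP=> x /setDP[xZ]; rewrite inE; apply: contra => xL.
  apply/bigcapP=> j; rewrite inE; apply: contraR => xA.
  by apply/bigcupP; exists x => //; rewrite ffunE inE xZ.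
have VC := cardsC (\bigcup_(x in L) N x); rewrite card_ord in VC.
have arith t y d v l z l' v' : t <= y + d -> d + v = l -> z <= l' ->
  l + l' = t -> v + v' = k -> z + k <= y + v' by lia.
exact: arith fcard dL (subset_leq_card sZL) (cardsC L) VC.
Qed.

(** * Rank functions and cyclic flats *)

Section MatroidRank.
Variables (S : finType) (M : matroid S).
Implicit Types X Y Z : {set S}.

Lemma mrankU_le X Y : mrank M (X :|: Y) <= mrank M X + mrank M Y.
Proof. by apply: leq_trans (mrank_submod M X Y); apply: leq_addr. Qed.

Lemma mrank_le_setD X Y : mrank M X <= mrank M Y + #|X :\: Y|.
Proof.
apply: (@leq_trans (mrank M (Y :|: X :\: Y))).
  by apply: mrank_mono; apply/subsetP=> x Xx; rewrite !inE Xx andbT orbN.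
by rewrite (leq_trans (mrankU_le _ _)) // leq_add2l mrank_le_card.
Qed.

Lemma mbasis_exists X :
  exists I : {set S}, [/\ I \subset X, mindependent M I & mrank M I = mrank M X].
Proof.
have [m] := ubnP #|X|; elim: m X => // m IHm X ltXm.
have [->|[x Xx]] := set_0Vmem X.
  exists set0; split=> //; apply/eqP.
  by rewrite /mindependent cards0 -leqn0 -(cards0 S) mrank_le_card.
have cX := cardsD1 x X; rewrite Xx /= in cX.
have [|I [sIX indI rI]] := IHm (X :\ x); first by rewrite cX in ltXm.
have leX : mrank M (X :\ x) <= mrank M X by apply/mrank_mono/subsetDl.
move: leX; rewrite leq_eqVlt => /predU1P[eqX|ltX].
  by exists I; rewrite rI (subset_trans sIX (subsetDl _ _)).
have xI : x \notin I by apply/negP=> /(subsetP sIX); rewrite !inE eqxx.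
have sub : x |: I \subset X.
  by rewrite subUset sub1set Xx (subset_trans sIX (subsetDl _ _)).
have cI : #|x |: I| = #|I|.+1 by rewrite cardsU1 xI.
have := mrank_submod M (x |: I) (X :\ x).
have -> : (x |: I) :|: (X :\ x) = X.
  by rewrite -setUA (setUidPr sIX) setD1K.
have leI : mrank M I <= mrank M ((x |: I) :&: (X :\ x)).
  by apply: mrank_mono; rewrite subsetI subsetUr.
have := mrank_le_card M (x |: I); have := mrank_mono M sub.
rewrite /mindependent in indI *; exists (x |: I); rewrite /mindependent.
by split=> //; lia.
Qed.

(** Start from Y = X and keep r(Y) + |X :\: Y| <= r(X). Adding an element that does not raise the
    rank, or deleting one whose deletion lowers it, preserves the bound; when neither is possible, Y
    is a cyclic flat. *)
Lemma mcyclic_flat_rank_le X :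
  exists2 Z, mcyclic_flat M Z & mrank M Z + #|X :\: Z| <= mrank M X.
Proof.
suff H Y : mrank M Y + #|X :\: Y| <= mrank M X ->
  exists2 Z, mcyclic_flat M Z & mrank M Z + #|X :\: Z| <= mrank M X.
  by apply: (H X); rewrite setDv cards0 addn0.
(* The measure is lexicographic: first the rank, then the size of the complement. *)
have [m] := ubnP (mrank M Y * #|S|.+1 + #|~: Y|).
elim: m Y => // m IHm Y lem leY.
have cYC := cardsC Y.
have [flatY|/forall_inPn[s Ys nlt]] :=
    boolP [forall s in ~: Y, mrank M Y < mrank M (s |: Y)]; last first.
  rewrite inE in Ys.
  have rsY : mrank M (s |: Y) <= mrank M Y by rewrite leqNgt.
  apply: (IHm (s |: Y)); last first.
    apply: leq_trans leY; apply: leq_add => //.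
    by apply: subset_leq_card; rewrite setDS // subsetUr.
  have := cardsC (s |: Y); rewrite cardsU1 Ys.
  have := leq_mul2r #|S|.+1 (mrank M (s |: Y)) (mrank M Y); rewrite rsY orbT.
  by lia.
have [cycY|/forall_inPn[x Yx neq]] :=
    boolP [forall x in Y, mrank M (Y :\ x) == mrank M Y].
  exists Y => //; split=> [s Ys | x Yx].
    by apply: (forall_inP flatY); rewrite inE.
  exact/eqP/(forall_inP cycY).
have ltx : mrank M (Y :\ x) < mrank M Y.
  by rewrite ltn_neqAle neq mrank_mono ?subsetDl.
apply: (IHm (Y :\ x)); last first.
  have : #|X :\: (Y :\ x)| <= #|X :\: Y|.+1.
    apply: leq_trans (subset_leq_card (_ : _ \subset x |: (X :\: Y))) _.
      apply/subsetP=> y; rewrite !inE negb_and negbK.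
      by case: (y == x) => //= /andP[-> ->].
    by rewrite cardsU1; case: (x \in _).
  by lia.
have := leq_mul2r #|S|.+1 (mrank M (Y :\ x)).+1 (mrank M Y).
rewrite ltx orbT mulSn; have := cardsC (Y :\ x); lia.
Qed.

End MatroidRank.

Section TransversalRank.
Variables (S : finType) (M : matroid S) (k : nat) (A : 'I_k -> {set S}).
Hypothesis transvA : forall X, mindependent M X <->
  has_avoidance_transversal (fun i => A i) (enum X).

Lemma transversal_rank_bigcap_le (J : {set 'I_k}) :
  mrank M (\bigcap_(j in J) A j) + #|J| <= k.
Proof.
have [I [sI indI <-]] := mbasis_exists M (\bigcap_(j in J) A j).
rewrite indI; have /transvA/has_avoidance_transversalP/(_ J) := indI.
congr (_ + _ <= _); rewrite cardE; apply/eqP; rewrite -all_count.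
apply/allP=> x; rewrite mem_enum => /(subsetP sI)/bigcapP xA.
exact/forall_inP.
Qed.

(** Koenig gives |Z :\: A_J| + k <= |Y| + |J| with Y independent in Z. If some z in Z were outside
    A_J, cyclicity would allow deleting it without changing r(Z), giving r(Z) <= r(A_J) + |Z :\:
    A_J| - 1 < r(Z). *)
Lemma transversal_rank_cyclic (Z : {set S}) : mcyclic M Z ->
  exists2 J : {set 'I_k}, Z \subset \bigcap_(j in J) A j & k <= mrank M Z + #|J|.
Proof.
move=> cycZ; have [Y [J [sYZ hatY le]]] := max_avoiding_subset A Z.
have leY : #|Y| <= mrank M Z.
  by have /transvA <- := hatY; apply: mrank_mono.
exists J; last by lia.
apply: contraT; rewrite -setD_eq0 => /set0Pn[z Zz].
have cz := cardsD1 z (Z :\: \bigcap_(j in J) A j); rewrite Zz /= in cz.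
have /setDP[zZ _] := Zz.
have := mrank_le_setD M (Z :\ z) (\bigcap_(j in J) A j).
rewrite cycZ // setDDl setUC -setDDl.
have leJ := transversal_rank_bigcap_le J => lez; exfalso.
have arith a j c d y r : c + k <= y + j -> y <= r -> c = 1 + d ->
  a + j <= k -> r <= a + d -> False by lia.
exact: arith le leY cz leJ lez.
Qed.

End TransversalRank.

Section QMatroidRank.
Variables (F : finFieldType) (E : vectType F) (M : qmatroid E).
Implicit Types X Y Z : {vspace E}.

Lemma qrankD_le X Y : qrank M (X + Y)%VS <= qrank M X + qrank M Y.
Proof. by apply: leq_trans (qrank_submod M X Y); apply: leq_addr. Qed.

Lemma qrank_le_dim_cap X Y :
  qrank M X + \dim (X :&: Y)%VS <= qrank M Y + \dim X.
Proof.
rewrite -[in \dim X](dimv_cap_compl X Y) addnCA addnC leq_add2l.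
rewrite -{1}(addv_diff_cap X Y) (leq_trans (qrankD_le _ _)) // addnC.
by rewrite leq_add ?qrank_le_dim // qrank_mono ?capvSr.
Qed.

(** The q-analogue of [mcyclic_flat_rank_le]: add a vector that does not raise the rank, or pass to
    a hyperplane of smaller rank, which costs at most one dimension of X :&: Y. *)
Lemma qcyclic_flat_rank_le X :
  exists2 Z, qcyclic_flat M Z &
    qrank M Z + \dim X <= qrank M X + \dim (X :&: Z)%VS.
Proof.
suff H Y : qrank M Y + \dim X <= qrank M X + \dim (X :&: Y)%VS ->
  exists2 Z, qcyclic_flat M Z &
    qrank M Z + \dim X <= qrank M X + \dim (X :&: Z)%VS.
  by apply: (H X); rewrite capvv.
have dimV := fun Y => dimvS (subvf Y).
have [m] := ubnP (qrank M Y * (\dim {:E}).+1 + (\dim {:E} - \dim Y)).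
elim: m Y => // m IHm Y lem leY.
have [flatY|nflatY] := classic (qflat M Y); last first.
  have [v nv] := not_all_ex_not _ _ nflatY.
  have [Yv /negP nlt] := imply_to_and _ _ nv.
  have rv : qrank M (Y + <[v]>)%VS <= qrank M Y by rewrite leqNgt.
  apply: (IHm (Y + <[v]>)%VS); last first.
    apply: leq_trans (leq_trans (leq_add rv (leqnn _)) leY) _.
    by rewrite leq_add2l dimvS // capvS ?addvSl.
  have ltv : \dim Y < \dim (Y + <[v]>)%VS.
    rewrite (ltn_leqif (dimv_leqif_sup (addvSl _ _))).
    by rewrite subv_add subvv /= -memvE.
  have := leq_mul2r (\dim {:E}).+1 (qrank M (Y + <[v]>)%VS) (qrank M Y).
  by rewrite rv orbT; have := dimV (Y + <[v]>)%VS; lia.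
have [cycY|ncycY] := classic (qcyclic M Y); first by exists Y.
have [H nH] := not_all_ex_not _ _ ncycY.
have [sHY {}nH] := imply_to_and _ _ nH.
have [dH /eqP neq] := imply_to_and _ _ nH.
have ltH : qrank M H < qrank M Y by rewrite ltn_neqAle neq qrank_mono.
apply: (IHm H); last first.
  suff : \dim (X :&: Y) <= (\dim (X :&: H)).+1 by lia.
  have := dimv_sum_cap (X :&: Y)%VS H.
  rewrite -capvA (capv_idPr sHY).
  have : \dim (X :&: Y + H)%VS <= \dim Y.
    by rewrite dimvS // subv_add capvSr.
  by lia.
have := leq_mul2r (\dim {:E}).+1 (qrank M H).+1 (qrank M Y).
rewrite ltH orbT mulSn; have := dimV H; lia.
Qed.

End QMatroidRank.

(** * Generic matrices with prescribed zeros *)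

Local Open Scope ring_scope.

(** Its row space is the coordinate subspace of S; being a 0-1 matrix it is stable under base
    change. *)
Definition coordmx (K : fieldType) (n : nat) (S : {set 'I_n}) : 'M[K]_n :=
  diag_mx (\row_i (i \in S)%:R).

Lemma sub_coordmxP (K : fieldType) (m n : nat) (Y : 'M[K]_(m, n)) (S : {set 'I_n}) :
  reflect (forall r i, i \notin S -> Y r i = 0) (Y <= coordmx K S)%MS.
Proof.
apply: (iffP idP) => [/submxP[D ->] r i iS | Y0].
  by rewrite mul_mx_diag !mxE (negPf iS) mulr0.
suff -> : Y = Y *m coordmx K S by apply: submxMl.
apply/matrixP=> r i; rewrite mul_mx_diag !mxE.
by have [|/Y0 ->] := boolP (i \in S); rewrite ?mulr1 ?mul0r.
Qed.

Lemma map_coordmx (K L : fieldType) (f : {rmorphism K -> L}) (n : nat)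
  (S : {set 'I_n}) : map_mx f (coordmx K S) = coordmx L S.
Proof.
by rewrite map_diag_mx; congr diag_mx; apply/rowP=> i; rewrite !mxE rmorph_nat.
Qed.

Lemma rank_coordmx_le (K : fieldType) (n : nat) (S : {set 'I_n}) :
  (\rank (coordmx K S) <= #|S|)%N.
Proof.
pose D := \matrix_(l < #|S|) (delta_mx 0 (enum_val l) : 'rV[K]_n).
suff sSD : (coordmx K S <= D)%MS by apply: leq_trans (mxrankS sSD) (rank_leq_row _).
apply/row_subP=> i; have [iS | iS] := boolP (i \in S).
  suff -> : row i (coordmx K S) = row (enum_rank_in iS i) D by apply: row_sub.
  apply/rowP=> j; rewrite rowK enum_rankK_in // !mxE eqxx.
  by rewrite iS eq_sym; case: eqP.
suff -> : row i (coordmx K S) = 0 by apply: sub0mx.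
by apply/rowP=> j; rewrite !mxE (negPf iS) mul0rn.
Qed.

(** The block B only adds its rank on the part of Y killed by g, and that part is still defined over
    K. *)
Lemma rank_mul_map_row_mx (K L : fieldType) (f : {rmorphism K -> L})
    (m n p k : nat) (Y : 'M[K]_(m, n)) (g : 'M[K]_(n, p)) (B : 'M[L]_(n, k)) :
  \rank (map_mx f Y *m row_mx (map_mx f g) B) =
    (\rank (Y *m g) + \rank (map_mx f (Y :&: kermx g)%MS *m B))%N.
Proof.
have rYg := mxrank_mul_ker Y g.
have := mxrank_mul_ker (map_mx f (Y :&: kermx g)%MS) B; rewrite mxrank_map => rB.
have := mxrank_mul_ker (map_mx f Y) (row_mx (map_mx f g) B).
rewrite mxrank_map => rgB.
suff : \rank (map_mx f Y :&: kermx (row_mx (map_mx f g) B))%MS =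
       \rank (map_mx f (Y :&: kermx g) :&: kermx B)%MS by lia.
apply/eqP; rewrite eqn_leq; apply/andP; split; apply: mxrankS.
  have := submx_refl (map_mx f Y :&: kermx (row_mx (map_mx f g) B))%MS.
  set W := (X in (X <= _)%MS -> _); rewrite !sub_capmx map_capmx sub_capmx.
  rewrite map_kermx !sub_kermx mul_mx_row row_mx_eq0.
  by case/andP=> -> /andP[-> ->].
have := submx_refl (map_mx f (Y :&: kermx g) :&: kermx B)%MS.
set W := (X in (X <= _)%MS -> _); rewrite !sub_capmx map_capmx sub_capmx.
rewrite map_kermx !sub_kermx mul_mx_row row_mx_eq0.
by case/andP=> /andP[-> ->] ->.
Qed.

Lemma finField_ext_large (F : finFieldType) (d : nat) :
  exists L : fieldExtType F, (d <= \dim {:L})%N.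
Proof.
(* The polynomial 'X^m - 'X has derivative -1, since m = 0 in F, so its splitting field has at least
   m elements. The exponent d.+1 keeps m > 1 even when d = 0. *)
pose m := (#|F| ^ d.+1)%N; pose p : {poly F} := 'X^m - 'X.
have m_gt1 : (1 < m)%N by rewrite -(exp1n d.+1) ltn_exp2r ?finNzRing_gt1.
have szp : size p = m.+1.
  by rewrite size_polyDl size_polyXn // size_polyN size_polyX.
have nz_p : p != 0 by rewrite -size_poly_eq0 szp.
have m0 : m%:R = 0 :> F.
  have [q q_pr qF] := finPcharP F.
  have cF : #|F| = (q ^ logn q #|F|)%N := card_pprimeChar qF.
  rewrite /m natrX [X in X ^+ _](_ : _ = 0) ?expr0n // cF natrX pcharf0 // expr0n.
  case: (logn q #|F|) cF => [|//] cF.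
  by have := finNzRing_gt1 F; rewrite cF.
have [L [zs Dp _]] := FinSplittingFieldFor nz_p.
exists L; pose Lf := FinFieldExtType L.
have sep : separable_poly (map_poly (in_alg L) p).
  rewrite separable_map separable_poly.unlock derivB derivXn derivX.
  rewrite -mulr_natr -[m%:R]polyC_natr m0 mulr0 sub0r.
  by rewrite -scaleN1r coprimepZr ?oppr_eq0 ?oner_eq0 // coprimep1.
have Uzs : uniq zs by rewrite -separable_prod_XsubC -(eqp_separable Dp).
have szs : size zs = m.
  by apply: succn_inj; rewrite -(size_prod_XsubC _ id) -(eqp_size Dp) size_map_poly.
have : (m <= #|Lf|)%N by rewrite -szs -(card_uniqP _ (s := (zs : seq Lf))) // max_card.
have -> : #|Lf| = (#|F| ^ \dim {:L})%N.
  by rewrite -(@card_vspacef F Lf (Vector.class L)) card_vspace.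
rewrite leq_exp2l ?finNzRing_gt1 //; exact: ltnW.
Qed.

Lemma free_row_exists (F : finFieldType) (n : nat) :
  exists (L : fieldExtType F) (g : 'cV[L]_n),
    forall y : 'rV[F]_n, map_mx (in_alg L) y *m g = 0 -> y = 0.
Proof.
have [L leL] := finField_ext_large F n.
exists L, (\col_i (vbasis {:L})`_i) => y /matrixP/(_ 0 0); rewrite !mxE => y0.
(* The entries of y, padded with zeros to the length of the basis, are coefficients of a vanishing
   combination. *)
pose c (i : 'I_(\dim {:L})) := \sum_(j < n | j == i :> nat) y 0 j.
have /freeP fr := basis_free (vbasisP {:L}).
have c0 : forall i, c i = 0.
  apply: fr; rewrite -[RHS]y0.
  under [in RHS]eq_bigr => j _ do rewrite !mxE mulr_algl.
  rewrite (eq_bigr (fun i : 'I_(\dim {:L}) =>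
     \sum_(j < n | j == i :> nat) y 0 j *: (vbasis {:L})`_j)); last first.
    by move=> i _; rewrite scaler_suml; apply: eq_bigr => j /eqP ->.
  rewrite (exchange_big_dep predT) //=; apply: eq_bigr => j _.
  by rewrite (big_pred1 (widen_ord leL j)) // => i; rewrite eq_sym.
apply/rowP=> j; rewrite mxE -[RHS](c0 (widen_ord leL j)) /c.
by rewrite (big_pred1 j).
Qed.

(** The induction generalizes F: the part of Y killed by the first column g is defined only over L1,
    so the remaining columns are chosen generically over L1. *)
Lemma generic_mx (n k : nat) (F : finFieldType) (A : 'I_k -> {set 'I_n}) :
  exists (L : fieldExtType F) (B : 'M[L]_(n, k)),
    (forall i j, i \in A j -> B i j = 0) /\
    forall m (Y : 'M[F]_(m, n)), exists J : {set 'I_k},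
      (k + \rank Y <= \rank (map_mx (in_alg L) Y *m B) + #|J| +
        \rank (Y :&: coordmx F (\bigcap_(j in J) A j))%MS)%N.
Proof.
elim: k F A => [|k IHk] F A.
  exists F^o, 0; split=> [? []//|m Y]; exists set0.
  rewrite big_set0 cards0 mulmx0 mxrank0 !add0n mxrankS // sub_capmx submx_refl.
  by apply/sub_coordmxP=> r i; rewrite inE.
have [L1 [g0 g0_free]] := free_row_exists F n.
pose g : 'cV[L1]_n := \col_i (if i \in A ord0 then 0 else g0 i 0).
have gP m (Y : 'M[F]_(m, n)) : map_mx (in_alg L1) Y *m g = 0 ->
    (Y <= coordmx F (A ord0))%MS.
  move=> Yg0; apply/sub_coordmxP=> r i iA.
  pose y : 'rV_n := \row_j (if j \in A ord0 then 0 else Y r j).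
  suff /rowP/(_ i) : y = 0 by rewrite !mxE (negPf iA).
  apply: g0_free; apply/matrixP=> a b; rewrite !ord1.
  move/matrixP/(_ r 0): Yg0; rewrite !mxE => Yg0; rewrite -[RHS]Yg0.
  by apply: eq_bigr => j _; rewrite !mxE; case: ifP; rewrite ?rmorph0 ?mul0r ?mulr0.
have [L2 [B' [B'0 B'P]]] := IHk (FinFieldExtType L1) (fun j => A (lift ord0 j)).
exists (baseFieldType L2), (row_mx (map_mx (in_alg L2) g) B' : 'M_(n, 1 + k)).
split=> [i j iA|m Y].
  rewrite mxE; case: splitP => j' jj'; last first.
    apply: B'0; suff -> : lift ord0 j' = j by [].
    exact: val_inj.
  have j0 : j = ord0 by apply: val_inj; rewrite /= jj' ord1.
  by rewrite !mxE -j0 iA rmorph0.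
have -> : map_mx (in_alg (baseFieldType L2)) Y =
    map_mx (in_alg L2) (map_mx (in_alg L1) Y) :> 'M[L2]_(m, n).
  by apply/matrixP=> r i; rewrite !mxE; apply: baseField_scaleE.
pose Y1 := map_mx (in_alg L1) Y.
set R := \rank (_ *m _); have rR : R = (\rank (Y1 *m g) +
    \rank (map_mx (in_alg L2) (Y1 :&: kermx g)%MS *m B'))%N.
  exact: (rank_mul_map_row_mx (in_alg L2) Y1 g B').
have [J leJ] : exists J : {set 'I_k},
    (k + \rank (Y1 :&: kermx g)%MS <=
       \rank (map_mx (in_alg L2) (Y1 :&: kermx g)%MS *m B') + #|J| +
       \rank (Y1 :&: kermx g :&:
         coordmx L1 (\bigcap_(j in J) A (lift ord0 j)))%MS)%N.
  exact: B'P.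
have rYg := mxrank_mul_ker Y1 g; rewrite mxrank_map in rYg.
set D := coordmx L1 _ in leJ.
have rD : \rank (Y1 :&: D)%MS =
    \rank (Y :&: coordmx F (\bigcap_(j in J) A (lift ord0 j)))%MS.
  by rewrite -(mxrank_map (in_alg L1)) map_capmx map_coordmx.
have rDg := mxrank_mul_ker (Y1 :&: D)%MS g; rewrite rD in rDg.
have rC : \rank (Y1 :&: kermx g :&: D)%MS = \rank (Y1 :&: D :&: kermx g)%MS.
  by rewrite -capmxA [(kermx g :&: D)%MS]capmxC capmxA.
have cJ : #|lift ord0 @: J| = #|J| by rewrite card_imset //; apply: lift_inj.
have bigJ : \bigcap_(j in lift ord0 @: J) A j = \bigcap_(j in J) A (lift ord0 j).
  by rewrite big_imset //= => ? ? _ _; apply: lift_inj.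
rewrite rC in leJ.
have arith y r yg K KB j j' d d' :
  (r = yg + KB -> yg + K = y -> k + K <= KB + j + d -> d + j < j' + d' ->
   k.+1 + y <= r + j' + d')%N by lia.
have {}arith := arith _ _ _ _ _ _ _ _ _ rR rYg leJ.
(* If g does not kill Y1 :&: D, dropping the kernel condition raises the intersection rank by at
   least one, which pays for the new column. Otherwise Y :&: C lies in the coordinate space of A
   ord0, so ord0 joins J without shrinking the intersection. *)
have [Dg0|Dg0] := eqVneq (\rank ((Y1 :&: D)%MS *m g)) 0%N; last first.
  exists (lift ord0 @: J); rewrite cJ bigJ.
  apply: arith; rewrite -rDg addnCA addnC -[X in (X < _)%N]add0n ltn_add2r.
  by rewrite lt0n.
exists (ord0 |: lift ord0 @: J).
have n0J : ord0 \notin lift ord0 @: J.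
  by apply/imsetP=> -[j _] /eqP; rewrite (negPf (neq_lift _ _)).
rewrite cardsU1 n0J cJ big_setU1 //= bigJ.
suff : (\rank (Y :&: coordmx F (\bigcap_(j in J) A (lift ord0 j)))%MS <=
  \rank (Y :&: coordmx F (A ord0 :&: \bigcap_(j in J) A (lift ord0 j)))%MS)%N.
  move=> leD; apply: arith; rewrite addnC add1n addSn ltnS leq_add2l.
  by apply: leq_trans leD; rewrite -rDg leq_addl.
set C := coordmx F (\bigcap_(j in J) _).
have CA : (Y :&: C <= coordmx F (A ord0))%MS.
  have sYD : (map_mx (in_alg L1) (Y :&: C)%MS <= Y1 :&: D)%MS.
    by rewrite map_capmx map_coordmx.
  have := mxrankS (submxMr g sYD); rewrite Dg0 leqn0 mxrank_eq0 => /eqP.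
  exact: gP.
apply: mxrankS; rewrite sub_capmx capmxSl; apply/sub_coordmxP=> r i.
rewrite inE negb_and => /orP[|] iA; first exact: (sub_coordmxP _ _ CA).
by apply: (sub_coordmxP _ _ (capmxSr Y C)).
Qed.

(** Rows of Y supported in A_J have products vanishing in the columns of J, so their images span at
    most k - |J| dimensions. *)
Lemma rank_mulmx_zero_pattern_le (K : fieldType) (m n k : nat)
    (A : 'I_k -> {set 'I_n}) (B : 'M[K]_(n, k)) (Y : 'M[K]_(m, n))
    (J : {set 'I_k}) :
  (forall i j, i \in A j -> B i j = 0) ->
  (\rank (Y *m B) + \rank (Y :&: coordmx K (\bigcap_(j in J) A j))%MS + #|J|
     <= k + \rank Y)%N.
Proof.
move=> B0; set W := (Y :&: _)%MS.
have W0 : (W *m B <= coordmx K (~: J))%MS.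
  apply/sub_coordmxP=> r j; rewrite inE negbK => jJ; rewrite mxE.
  apply: big1 => i _; have [iA|iA] := boolP (i \in A j).
    by rewrite B0 ?mulr0.
  rewrite (sub_coordmxP _ _ (capmxSr Y _)) ?mul0r //.
  by apply: contra iA => /bigcapP; apply.
have rWB := leq_trans (mxrankS W0) (rank_coordmx_le _ _).
have rYB := mxrank_mul_ker Y B; have rW := mxrank_mul_ker W B.
have rker : (\rank (W :&: kermx B)%MS <= \rank (Y :&: kermx B)%MS)%N.
  by rewrite mxrankS // capmxS // capmxSl.
have cJ := cardsC J; rewrite card_ord in cJ.
rewrite -rYB -rW; have arith a b c d j j' : (b <= j' -> c <= d -> j + j' = k ->
  a + (b + c) + j <= k + (a + d))%N by lia.
exact: arith rWB rker cJ.
Qed.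

(** * Coordinate subspaces *)

Section RowSpaces.
Variables (F : finFieldType) (n : nat).
Implicit Types (v : 'rV[F]_n) (S : {set 'I_n}).

Lemma span_submx (m : nat) (A : 'M[F]_(m, n)) (s : seq 'rV[F]_n) v :
  {in s, forall u, (u <= A)%MS} -> v \in <<s>>%VS -> (v <= A)%MS.
Proof.
move=> sA /(coord_span (X := in_tuple s)) ->.
apply: summx_sub => i _; apply: scalemx_sub; apply: sA.
exact: mem_nth.
Qed.

Lemma memv_row_space (m : nat) (A : 'M[F]_(m, n)) v :
  (v \in row_space A) = (v <= A)%MS.
Proof.
apply/idP/idP=> [|/submxP[D ->]].
  by apply: span_submx => _ /imageP[i _ ->]; apply: row_sub.
rewrite mulmx_sum_row; apply: memv_suml => i _; apply: memvZ.
by apply: memv_span; apply: image_f.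
Qed.

Lemma memv_coord_space S v : (v \in coord_space F S) = (v <= coordmx F S)%MS.
Proof.
apply/idP/idP=> [|/sub_coordmxP v0].
  apply: span_submx => _ /imageP[i iS ->]; apply/sub_coordmxP=> r j jS.
  by rewrite mxE; case: (eqVneq j i) jS => [->|_ _]; rewrite ?iS // andbF.
rewrite (row_sum_delta v); apply: memv_suml => i _.
have [iS|/v0 ->] := boolP (i \in S); last by rewrite scale0r mem0v.
by apply: memvZ; apply: memv_span; apply: image_f.
Qed.

Lemma memv_coord_spaceP S v :
  reflect (forall i, i \notin S -> v 0 i = 0) (v \in coord_space F S).
Proof.
rewrite memv_coord_space; apply: (iffP (sub_coordmxP _ _)) => v0 => [i|r i].
  exact: v0.
by rewrite ord1; apply: v0.
Qed.

Lemma memv_coord_bigcap (I : finType) (A : I -> {set 'I_n}) (J : {set I}) v :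
  (v \in coord_space F (\bigcap_(j in J) A j)) =
    [forall j in J, v \in coord_space F (A j)].
Proof.
apply/memv_coord_spaceP/forall_inP => [v0 j jJ | vA i].
  apply/memv_coord_spaceP=> i iA; apply: v0.
  by apply: contra iA => /bigcapP; apply.
move=> iA; have [j jJ ij] : exists2 j, j \in J & i \notin A j.
  apply/exists_inP; rewrite -negb_forall_in; apply: contra iA.
  by move/forall_inP=> iA; apply/bigcapP.
by move/memv_coord_spaceP: (vA j jJ); apply.
Qed.

Lemma coord_spaceS S1 S2 : S1 \subset S2 -> (coord_space F S1 <= coord_space F S2)%VS.
Proof.
move=> S12; apply/subvP=> v /memv_coord_spaceP v0; apply/memv_coord_spaceP=> i iS.
by apply: v0; apply: contra iS; apply/subsetP.
Qed.

Lemma coord_space_le_setD S1 S2 :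
  (coord_space F S1 <= coord_space F S2 + coord_space F (S1 :\: S2))%VS.
Proof.
apply/span_subvP=> _ /imageP[i iS ->].
suff : exists S, [/\ i \in S & (coord_space F S <=
    coord_space F S2 + coord_space F (S1 :\: S2))%VS].
  move=> [S [iS' /subvP]]; apply; apply: memv_span.
  exact: image_f.
have [iS2|iS2] := boolP (i \in S2).
  by exists S2; rewrite iS2 addvSl.
by exists (S1 :\: S2); rewrite inE iS iS2 addvSr.
Qed.

Lemma dim_coord_space_le S : (\dim (coord_space F S) <= #|S|)%N.
Proof. by apply: leq_trans (dim_span _) _; rewrite size_image. Qed.

Lemma dim_row_space (m : nat) (A : 'M[F]_(m, n)) : \dim (row_space A) = \rank A.
Proof.
pose f := linfun (mulmxr (row_base A) : 'rV_(\rank A) -> 'rV_n).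
have -> : row_space A = (f @: fullv)%VS.
  apply/vspaceP=> v; rewrite memv_row_space -(eq_row_base A).
  apply/submxP/memv_imgP=> [[D ->]|[D _ ->]].
    by exists D; rewrite ?memvf ?lfunE.
  by exists D; rewrite lfunE.
rewrite limg_dim_eq; first by rewrite dimvf dim_matrix; apply: mul1n.
apply/eqP; rewrite capfv -subv0; apply/subvP=> v.
rewrite memv_ker lfunE memv0 /= => /eqP vA0.
by apply/eqP/(row_free_inj (row_base_free A)); rewrite vA0 mul0mx.
Qed.

Lemma dim_row_space_cap_coord (m : nat) (A : 'M[F]_(m, n)) S :
  \dim (row_space A :&: coord_space F S)%VS = \rank (A :&: coordmx F S)%MS.
Proof.
rewrite -dim_row_space; congr (\dim _); apply/vspaceP=> v.
by rewrite memv_cap !memv_row_space memv_coord_space sub_capmx.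
Qed.

End RowSpaces.

(** * Coordinate q-matroids *)

Section CoordinateTransversal.
Variables (F : finFieldType) (n : nat).
Variables (Mq : qmatroid 'rV[F]_n) (N : matroid 'I_n).
Hypothesis coordMq : coordinate_qmatroid Mq.
Hypothesis corrN : corresponding_matroid Mq N.

(** The ranks agree on the cyclic flat Z computing r(S), and S :\: Z adds at most its size. The
    bound will be applied to A_J, which need not be a cyclic flat. *)
Lemma qrank_coord_space_le S : (qrank Mq (coord_space F S) <= mrank N S)%N.
Proof.
have [Z cfZ le] := mcyclic_flat_rank_le N S.
apply: leq_trans le; rewrite (proj2 corrN) //.
apply: leq_trans (qrank_mono _ (coord_space_le_setD F S Z)) _.
apply: leq_trans (qrankD_le _ _ _) _; rewrite leq_add2l.
exact: leq_trans (qrank_le_dim _ _) (dim_coord_space_le _ _).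
Qed.

Variables (k : nat) (A : 'I_k -> {set 'I_n}).
Hypothesis transvA : forall X, mindependent N X <->
  has_avoidance_transversal (fun i => A i) (enum X).
Implicit Types (X : {vspace 'rV[F]_n}) (J : {set 'I_k}).

Local Notation phiA J := (coord_space F (\bigcap_(j in J) A j)).

Lemma coord_qrank_le X J :
  (qrank Mq X + \dim (X :&: phiA J)%VS + #|J| <= k + \dim X)%N.
Proof.
have := qrank_le_dim_cap Mq X (phiA J).
have := qrank_coord_space_le (\bigcap_(j in J) A j).
have := transversal_rank_bigcap_le transvA J.
set d := \dim (X :&: _)%VS; have arith r rJ qJ j dX :
  (rJ + j <= k -> qJ <= rJ -> r + d <= qJ + dX -> r + d + j <= k + dX)%N by lia.
exact: arith.
Qed.

(** Coordinateness enters here: the cyclic flat computing rho(X) is phi(S) with S a cyclic flat of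
    N, and enlarging S to A_J only increases the intersection with X. *)
Lemma coord_qrank_ge X :
  exists J, (k + \dim X <= qrank Mq X + \dim (X :&: phiA J)%VS + #|J|)%N.
Proof.
have [Z cfZ le] := qcyclic_flat_rank_le Mq X.
have [S ZS] := coordMq cfZ; rewrite {Z}ZS in cfZ le.
have cfS := (proj1 corrN S).2 cfZ; have [_ cycS] := cfS.
have [J sSJ leJ] := transversal_rank_cyclic transvA cycS.
exists J; rewrite (proj2 corrN) // in leJ.
have := dimvS (capvS (subvv X) (coord_spaceS F sSJ)).
set d := \dim (X :&: phiA J)%VS; have arith r rS j dX dS :
  (rS + dX <= r + dS -> k <= rS + j -> dS <= d -> k + dX <= r + d + j)%N by lia.
exact: arith le leJ.
Qed.

Lemma qindependent_coordP X :
  qindependent Mq X <-> forall J, (\dim (X :&: phiA J)%VS + #|J| <= k)%N.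
Proof.
split=> [indX J|leX].
  have := coord_qrank_le X J; rewrite indX -addnA addnC leq_add2r.
  by [].
have [J] := coord_qrank_ge X; rewrite -addnA => le.
apply/eqP; rewrite eqn_leq qrank_le_dim /=.
by rewrite -(leq_add2l k) (leq_trans le) // addnC leq_add2r.
Qed.

Lemma partial_qtransversal_coordP X :
  partial_qtransversal (fun j => coord_space F (A j)) X <->
  forall J, (\dim (X :&: phiA J)%VS + #|J| <= k)%N.
Proof.
split=> [pqX J|leX b bX].
  pose Y := (X :&: phiA J)%VS.
  (* A basis of X adapted to X :&: phi(A_J) is the worst case of Hall's condition for J. *)
  have bX : basis_of X (vbasis Y ++ vbasis (X :\: phiA J)%VS).
    rewrite -[X in basis_of X _](addv_diff_cap X (phiA J)) addvC.
    rewrite cat_basis ?vbasisP //; apply/directv_addP/eqP.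
    by rewrite -subv0 -(capv_diff X (phiA J)) capvC capvS ?capvSr.
  have /has_avoidance_transversalP/(_ J) := pqX _ bX.
  apply: leq_trans; rewrite leq_add2r count_cat.
  apply: leq_trans (leq_addr _ _); rewrite -[X in (X <= _)%N](size_tuple (vbasis Y)).
  rewrite -[X in (X <= _)%N]count_predT; apply/eq_leq/eq_in_count=> v /vbasis_mem.
  by rewrite memv_cap memv_coord_bigcap => /andP[_ ->].
(* In any basis of X, the vectors lying in phi(A_J) are independent in X :&: phi(A_J). *)
apply/has_avoidance_transversalP=> J; apply: leq_trans (leX J).
rewrite leq_add2r -size_filter; set c := filter _ b.
have /eqP <- : free c by rewrite filter_free ?(basis_free bX).
apply/dimvS/span_subvP=> v; rewrite mem_filter => /andP[vJ vb].
by rewrite memv_cap memv_coord_bigcap vJ (basis_mem bX).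
Qed.

Lemma coord_transversal_qmatroid : transversal_qmatroid Mq.
Proof.
exists k, (fun j => coord_space F (A j)) => X.
by rewrite qindependent_coordP partial_qtransversal_coordP.
Qed.

Lemma coord_transversal_representable : representable Mq.
Proof.
have [L [B [B0 BP]]] := generic_mx F A.
exists L, k, B^T => X m Y YX.
rewrite -trmx_mul mxrank_tr; have dX := dim_row_space Y.
have [J leJ] := BP m Y; have [J' leJ'] := coord_qrank_ge X.
have rJ := coord_qrank_le X J.
have := rank_mulmx_zero_pattern_le (map_mx (in_alg L) Y) J' B0.
rewrite -(map_coordmx (in_alg L)).
have -> : \rank (map_mx (in_alg L) Y :&:
      map_mx (in_alg L) (coordmx F (\bigcap_(j in J') A j)))%MS
    = \rank (Y :&: coordmx F (\bigcap_(j in J') A j))%MS.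
  by rewrite -map_capmx mxrank_map.
rewrite mxrank_map => rJ'.
rewrite -!dim_row_space_cap_coord -!dX YX in leJ rJ'.
(* The chain is rho(X) <= f(X, J) <= rank <= f(X, J') <= rho(X), with J from the generic matrix and
   J' from the q-matroid. *)
have arith q r j j' d d' x : (k + x <= r + j + d -> k + x <= q + d' + j' ->
  q + d + j <= k + x -> r + d' + j' <= k + x -> q = r)%N by lia.
exact: arith leJ leJ' rJ rJ'.
Qed.

End CoordinateTransversal.

Theorem theorem3p15 (F : finFieldType) (n : nat)
    (Mq : qmatroid 'rV[F]_n) (N : matroid 'I_n) :
  coordinate_qmatroid Mq ->
  corresponding_matroid Mq N ->
  transversal_matroid N ->
  transversal_qmatroid Mq /\ representable Mq.
Proof.
move=> coordMq corrN [k [A transvA]]; split.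
  exact: coord_transversal_qmatroid coordMq corrN _ _ transvA.
exact: coord_transversal_representable coordMq corrN _ _ transvA.
Qed.
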